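(* Consider the convex mixed-integer problem $(P)$, assumed feasible, and suppose that for every $\hat{y} \in Y^*$ a constraint qualification (Abadie's) holds at all optimal solutions of the subproblem $\mathrm{NLP}(\hat{y})$. Then the adapted outer approximation algorithm described in the context converges in a finite number of iterations, i.e. its stopping criterion $\mathrm{LBD} = \mathrm{UBD}$ is met after finitely many iterations.
   Context: Problem $(P)$ is: minimize $f(x,y) = c^\top x + d^\top y$ subject to $g(x,y) \le 0$, $x \in X$, $y \in Y$. Here $c \in \mathbb{R}^n$, $d \in \mathbb{R}^m$; $X \subset \mathbb{R}^n$ is a nonempty compact convex set defined by (finitely many) linear inequalities; $Y \subset \mathbb{Z}^m$ is finite; and $g = (g_1,\dots,g_p) \colon \mathbb{R}^{n+m} \to \mathbb{R}^p$ is convex (each $g_i$ is convex) and once continuously differentiable. The optimal value of $(P)$ is denoted $f^*$. Let $Y^* = \{y \in \mathbb{Z}^m : \exists x \in \mathbb{R}^n \text{ such that } (x,y) \text{ is optimal for } (P)\} \subset Y$. For $\hat{y} \in Y$, the subproblem $\mathrm{NLP}(\hat{y})$ is: minimize $c^\top x + d^\top \hat{y}$ subject to $g(x,\hat{y}) \le 0$, $x \in X$. Abadie's constraint qualification holds at a feasible point $\bar{x}$ of $\mathrm{NLP}(\hat{y})$ if the tangent cone at $\bar{x}$ to the feasible set of $\mathrm{NLP}(\hat{y})$ equals the set of first-order feasible directions at $\bar{x}$, i.e. the set of $v \in \mathbb{R}^n$ with $\nabla_x g_i(\bar{x},\hat{y})^\top v \le 0$ for every $i$ with $g_i(\bar{x},\hat{y})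 = 0$ and $a^\top v \le 0$ for every linear inequality $a^\top x \le b$ defining $X$ with $a^\top \bar{x} = b$. The gradient cut of $g_i$ at a point $\hat{z} \in \mathbb{R}^{n+m}$ is the linear inequality $g_i(\hat{z}) + \nabla g_i(\hat{z})^\top (z - \hat{z}) \le 0$ in $z = (x,y)$. Adapted outer approximation algorithm. Start with $\mathrm{LBD} = -\infty$, $\mathrm{UBD} = \infty$ and a finite (possibly empty) collection of gradient cuts. In each iteration $k$, solve the MILP subproblem of minimizing $c^\top x + d^\top y$ over all $(x,y) \in X \times Y$ satisfying all cuts collected so far; let $(x^k, y^k)$ be any optimal solution and set $\mathrm{LBD} = f(x^k,y^k)$. If $\mathrm{NLP}(y^k)$ is feasible, replace $\mathrm{UBD}$ by the minimum of $\mathrm{UBD}$ and the optimal value of $\mathrm{NLP}(y^k)$. Stop as soon as $\mathrm{LBD} = \mathrm{UBD}$. Otherwise add cuts to the collection as follows and continue with the next iteration: (i) If $\mathrm{NLP}(y^k)$ is infeasible, add an OA cut from the NLP feasibility problem: gradient cuts of the constraints at a point $(\bar{x}, y^k)$, where $\bar{x} \in X$ solves a feasibility problem minimizing a measure of the violation of $g(\cdot,y^k) \le 0$. As is standard in outer approximation, these cuts exclude the integer assignment $y^k$: there is no $x \in X$ such that $(x,y^k)$ satisfies all of them. (ii) If $y^k \in Y^*$, add an ordinary OA cut: the gradient cuts at $(\bar{x}, y^k)$ of the constraints $g_i$ active there (i.e. with $g_i(\bar{x},y^k) = 0$), where $\bar{x}$ is an optimal solution of $\mathrm{NLP}(y^k)$.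 (iii) If $\mathrm{NLP}(y^k)$ is feasible but $y^k \notin Y^*$, add an ECP cut: the gradient cut at $(x^k,y^k)$ of a most violated constraint, i.e. of some $g_i$ with $g_i(x^k,y^k) = \max_j g_j(x^k,y^k)$. *)

(* Defs.v *)
(* MathComp-Analysis; vectors of R^n are row vectors 'rV[R]_n. *)
From HB Require Import structures.
From mathcomp Require Import all_boot all_order all_algebra.
From mathcomp Require Import all_classical all_reals all_analysis.

Set Implicit Arguments.
Unset Strict Implicit.
Unset Printing Implicit Defensive.

Import Order.TTheory GRing.Theory Num.Theory.
Import numFieldNormedType.Exports.

Local Open Scope classical_set_scope.
Local Open Scope ring_scope.

Section Calculus.
Context {R : realType}.

Definition dot {n : nat} (u v : 'rV[R]_n) : R := \sum_j u 0 j * v 0 j.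

Definition grad {n : nat} (f : 'rV[R]_n -> R) (z : 'rV[R]_n) : 'rV[R]_n :=
  \row_j 'D_(delta_mx 0 j) f z.

Definition continuously_differentiable {n : nat} (f : 'rV[R]_n -> R) : Prop :=
  (forall z, differentiable f z) /\ continuous (grad f).

(* Bouligand's (contingent) tangent cone to S at x. *)
Definition tangent_cone {n : nat} (S : set 'rV[R]_n) (x : 'rV[R]_n) :
    set 'rV[R]_n :=
  [set v | exists (u : nat -> 'rV[R]_n) (t : nat -> R),
     [/\ forall k, S (u k),
         forall k, 0 < t k,
         u @ \oo --> x,
         t @ \oo --> (0 : R) &
         (fun k => (t k)^-1 *: (u k - x)) @ \oo --> v]].

End Calculus.

(* Data of (P): minimize c.x + d.y subject to g_i(x, y) <= 0 for all i < p,
   A x <= b (q linear inequalities, defining X) and y in Y, where y is integer: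
   the fields are c, d, A, b, Y and g. Convexity, smoothness, compactness and
   finiteness are assumed in [convex_minlp]; convexity of X follows from its
   being polyhedral. *)
Record minlp (R : realType) (n m p q : nat) := Minlp {
  cost_x : 'rV[R]_n;
  cost_y : 'rV[R]_m;
  lin_lhs : 'M[R]_(q, n);
  lin_rhs : 'I_q -> R;
  int_set : set 'rV[int]_m;
  constr : 'I_p -> 'rV[R]_(n + m) -> R
}.

Section Problem.
Context {R : realType} {n m p q : nat} (P : minlp R n m p q).

Local Notation c := (cost_x P).
Local Notation d := (cost_y P).
Local Notation A := (lin_lhs P).
Local Notation b := (lin_rhs P).
Local Notation Y := (int_set P).
Local Notation g := (constr P).

Definition cont_set : set 'rV[R]_n := [set x | forall i, dot (row i A) x <= b i].
Local Notation X := cont_set.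

(* The point (x, y) of R^(n+m), for an integer vector y. *)
Definition pt (x : 'rV[R]_n) (y : 'rV[int]_m) : 'rV[R]_(n + m) :=
  row_mx x (map_mx intr y).

Definition objective (x : 'rV[R]_n) (y : 'rV[int]_m) : R :=
  dot c x + dot d (map_mx intr y).
Local Notation f := objective.

Definition convex_minlp : Prop :=
  [/\ X !=set0,
      compact X,
      finite_set Y,
      forall i, convex_function setT (g i) &
      forall i, continuously_differentiable (g i)].

Definition feasible (x : 'rV[R]_n) (y : 'rV[int]_m) : Prop :=
  [/\ X x, Y y & forall i, g i (pt x y) <= 0].

Definition optimal (x : 'rV[R]_n) (y : 'rV[int]_m) : Prop :=
  feasible x y /\ forall x' y', feasible x' y' -> f x y <= f x' y'.

Definition Ystar : set 'rV[int]_m := [set y | exists x, optimal x y].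

Definition nlp_set (y : 'rV[int]_m) : set 'rV[R]_n :=
  [set x | X x /\ forall i, g i (pt x y) <= 0].

Definition nlp_feasible (y : 'rV[int]_m) : Prop := nlp_set y !=set0.

Definition nlp_optimal (y : 'rV[int]_m) (x : 'rV[R]_n) : Prop :=
  nlp_set y x /\ forall x', nlp_set y x' -> f x y <= f x' y.

Definition nlp_value (y : 'rV[int]_m) : \bar R :=
  ereal_inf [set (f x y)%:E | x in nlp_set y].

(* [lsubmx (grad (g i) (pt x y))] is the gradient in x of g_i at (x, y). *)
Definition first_order_directions (y : 'rV[int]_m) (x : 'rV[R]_n) :
    set 'rV[R]_n :=
  [set v | (forall i, g i (pt x y) = 0 ->
              dot (lsubmx (grad (g i) (pt x y))) v <= 0) /\
           (forall i, dot (row i A) x = b i -> dot (row i A) v <= 0)].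

Definition abadie (y : 'rV[int]_m) (x : 'rV[R]_n) : Prop :=
  tangent_cone (nlp_set y) x = first_order_directions y x.

(* The pair (i, zh) stands for the gradient cut of g_i at zh. *)
Definition cut : Type := ('I_p * 'rV[R]_(n + m))%type.

Definition satisfies (z : 'rV[R]_(n + m)) (w : cut) : Prop :=
  let: (i, zh) := w in g i zh + dot (grad (g i) zh) (z - zh) <= 0.

Definition milp_feasible (C : set cut) (x : 'rV[R]_n) (y : 'rV[int]_m) : Prop :=
  [/\ X x, Y y & forall w, C w -> satisfies (pt x y) w].

Definition milp_optimal (C : set cut) (x : 'rV[R]_n) (y : 'rV[int]_m) : Prop :=
  milp_feasible C x y /\
  forall x' y', milp_feasible C x' y' -> f x y <= f x' y'.

(* A measure of the violation of u <= 0, possibly depending on y: it is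
   strictly smaller where u <= 0 holds than where it is violated. The value
   +oo allows for feasibility problems that keep some of the constraints hard. *)
Definition violation_measure (viol : 'rV[int]_m -> 'rV[R]_p -> \bar R) : Prop :=
  forall y (u u' : 'rV[R]_p),
    (forall i, u 0 i <= 0) -> (exists i, 0 < u' 0 i) ->
    (viol y u < viol y u')%E.

Section Algorithm.
Variable viol : 'rV[int]_m -> 'rV[R]_p -> \bar R.

Definition violation (y : 'rV[int]_m) (x : 'rV[R]_n) : \bar R :=
  viol y (\row_i g i (pt x y)).

Definition solves_feasibility (y : 'rV[int]_m) (xb : 'rV[R]_n) : Prop :=
  X xb /\ forall x, X x -> (violation y xb <= violation y x)%E.

Definition gradient_cuts_at (z : 'rV[R]_(n + m)) : set cut :=
  [set w | w.2 = z].

Definition excludes (C : set cut) (y : 'rV[int]_m) : Prop :=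
  ~ exists x, X x /\ forall w, C w -> satisfies (pt x y) w.

(* For every integer assignment with an infeasible subproblem, the feasibility
   problem is solvable and the cuts at any of its solutions exclude that
   assignment. *)
Definition feasibility_cuts_exclude : Prop :=
  forall y, Y y -> ~ nlp_feasible y ->
    (exists xb, solves_feasibility y xb) /\
    (forall xb, solves_feasibility y xb ->
       excludes (gradient_cuts_at (pt xb y)) y).

(* [new_cuts x y D]: D is a possible choice for the set of cuts added when
   (x, y) is the solution found for the MILP subproblem. *)
Variant new_cuts (x : 'rV[R]_n) (y : 'rV[int]_m) : set cut -> Prop :=
| OA_feasibility_cut xb of
    ~ nlp_feasible y & solves_feasibility y xb :
    new_cuts x y (gradient_cuts_at (pt xb y))
| OA_cut xb of
    Ystar y & nlp_optimal y xb :
    new_cuts x y [set w | w.2 = pt xb y /\ g w.1 (pt xb y) = 0]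
| ECP_cut i of
    nlp_feasible y & ~ Ystar y & (forall j, g j (pt x y) <= g i (pt x y)) :
    new_cuts x y [set (i, pt x y)].

Record state := State { cuts : set cut; lbd : \bar R; ubd : \bar R }.

Definition initial (s : state) : Prop :=
  [/\ finite_set (cuts s), lbd s = -oo%E & ubd s = +oo%E].

Definition stopped (s : state) : Prop := lbd s = ubd s.

(* One iteration; no cuts are added when the stopping criterion is met. *)
Definition iteration (s s' : state) : Prop :=
  exists (x : 'rV[R]_n) (y : 'rV[int]_m),
    [/\ milp_optimal (cuts s) x y,
        lbd s' = (f x y)%:E,
        (nlp_feasible y -> ubd s' = Order.min (ubd s) (nlp_value y)),
        (~ nlp_feasible y -> ubd s' = ubd s) &
        if `[< stopped s' >] then cuts s' = cuts s
        else exists2 D, new_cuts x y D & cuts s' = cuts s `|` D].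

(* A maximal execution: [s k] is the state after k iterations, and the
   algorithm iterates until the stopping criterion is met. If it ever got stuck
   in a state where no iteration can be carried out, the sequence would stay
   constant from there on, so that such an execution never stops. The sequence
   is irrelevant after a stopped state. *)
Definition execution (s : nat -> state) : Prop :=
  initial (s 0%N) /\
  forall k, ~ stopped (s k) ->
    iteration (s k) (s k.+1) \/
    (~ (exists s', iteration (s k) s')) /\ s k.+1 = s k.

End Algorithm.
End Problem.

(* Main.v *)
(* Every gradient cut is valid for (P), so each LBD is at most the optimal value
   f*, while each UBD is at least f*; compactness keeps every MILP subproblem
   solvable. If the algorithm never stopped, finiteness of Y would make some
   integer assignment y recur infinitely often.
   - If NLP(y) is infeasible, the cuts of the first visit exclude y.
   - If y is in Y*, let xb be the optimal point where the first visit cuts. For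
     any x in X satisfying those cuts, x - xb is a first-order feasible
     direction, hence by Abadie's condition a tangent direction, along which the
     linear objective cannot decrease. So LBD = f* = UBD at the second visit.
   - If NLP(y) is feasible but y is not in Y*, the points x^k of the visits
     cluster at some a in X. Were (a, y) to violate a constraint, the cut of the
     most violated constraint at one visit close to a would cut off the point of
     any later visit close to a. So (a, y) is feasible with value at most f*,
     which puts y in Y*. *)
Require Import Defs.
From HB Require Import structures.
From mathcomp Require Import all_boot all_order all_algebra.
From mathcomp Require Import all_classical all_reals all_analysis.
From mathcomp Require Import lra.

Set Implicit Arguments.
Unset Strict Implicit.
Unset Printing Implicit Defensive.

Import Order.TTheory GRing.Theory Num.Theory.
Import numFieldNormedType.Exports.

Local Open Scope classical_set_scope.
Local Open Scope ring_scope.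

(** * Dot products and the gradient inequality *)

Section Calculus.
Context {R : realType}.

Lemma dotDr n (u v w : 'rV[R]_n) : dot u (v + w) = dot u v + dot u w.
Proof.
by rewrite /dot -big_split; apply: eq_bigr => j _; rewrite mxE mulrDr.
Qed.

Lemma dotZr n (a : R) (u v : 'rV[R]_n) : dot u (a *: v) = a * dot u v.
Proof.
by rewrite /dot mulr_sumr; apply: eq_bigr => j _; rewrite mxE mulrCA.
Qed.

Lemma dotNr n (u v : 'rV[R]_n) : dot u (- v) = - dot u v.
Proof. by rewrite -scaleN1r dotZr mulN1r. Qed.

Lemma dotBr n (u v w : 'rV[R]_n) : dot u (v - w) = dot u v - dot u w.
Proof. by rewrite dotDr dotNr. Qed.

Lemma dotr0 n (u : 'rV[R]_n) : dot u 0 = 0.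
Proof. by rewrite -(scale0r 0) dotZr mul0r. Qed.

Lemma dot_row_mxr0 n m (u : 'rV[R]_(n + m)) (v : 'rV[R]_n) :
  dot u (row_mx v 0) = dot (lsubmx u) v.
Proof.
rewrite /dot big_split_ord/= [X in _ + X]big1 ?addr0 => [|j _].
  by apply: eq_bigr => j _; rewrite row_mxEl mxE.
by rewrite row_mxEr mxE mulr0.
Qed.

Lemma cvg_dot {T : Type} {F : set_system T} {FF : Filter F} n
    (u v : T -> 'rV[R]_n) (a b : 'rV[R]_n) :
  u @ F --> a -> v @ F --> b -> (fun t => dot (u t) (v t)) @ F --> dot a b.
Proof.
move=> ua vb; rewrite /dot; apply: (cvg_big (op := +%R)) => [|j _].
  exact: add_continuous.
apply: cvgM.
  exact: (cvg_comp _ _ ua (@coord_continuous _ _ _ 0 j a)).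
exact: (cvg_comp _ _ vb (@coord_continuous _ _ _ 0 j b)).
Qed.

Lemma derive_dot_grad n (f : 'rV[R]_n -> R) (z v : 'rV[R]_n) :
  differentiable f z -> 'D_v f z = dot (grad f z) v.
Proof.
move=> df; rewrite deriveE// {1}[v]row_sum_delta linear_sum/=.
by apply: eq_bigr => j _; rewrite linearZ/= mxE deriveE// mulrC.
Qed.

(** By convexity, the difference quotients at [z] along [z' - z] with step [h] in (0,1) are at most
    [f z' - f z]; so is their limit as [h] decreases to 0. *)
Lemma gradient_inequality n (f : 'rV[R]_n -> R) (z z' : 'rV[R]_n) :
  convex_function setT f -> differentiable f z ->
  f z + dot (grad f z) (z' - z) <= f z'.
Proof.
move=> cf df; rewrite -derive_dot_grad// addrC -lerBrDr.
have dv := diff_derivable df (v := z' - z).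
apply: (cvgr_to_le (cvg_dnbhs_at_right dv)).
near=> h.
have h0 : 0 < h by near: h; exact: nbhs_right_gt.
have h1 : h < 1 by near: h; exact: nbhs_right_lt.
have := cf (Itv01 (ltW h0) (ltW h1)) z' z (in_setT _) (in_setT _).
rewrite {1}/conv/= /unstable.onem.
have -> : h *: (z' : 'rV[R]_n) + (1 - h) *: (z : 'rV[R]_n) =
    h *: (z' - z) + z.
  by rewrite scalerBl scale1r scalerBr [z - _]addrC addrA.
rewrite convRE/= /unstable.onem ler_pdivrMl// => cfh; lra.
Unshelve. all: by end_near. Qed.

End Calculus.

(** * Cluster points, recurrence and finite minima *)

Lemma cluster_frequently {T : topologicalType} (K : set T) (V : nat -> Prop)
    (u : nat -> T) :
  compact K -> (forall k, V k -> K (u k)) ->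
  (forall N, exists2 k, (N <= k)%N & V k) ->
  exists2 a, K a & forall U, nbhs a U ->
    forall N, exists k, [/\ (N <= k)%N, V k & U (u k)].
Proof.
move=> cK VK Vinf.
(* [F] is generated by the images of the tails of [V]; every neighbourhood of a cluster point of [F]
   meets each of them. *)
pose F := filter_from [set: nat]
  (fun N => [set u k | k in [set k | (N <= k)%N /\ V k]]).
have FF : ProperFilter F.
  apply: filter_from_proper; last first.
    by move=> N _; have [k Nk Vk] := Vinf N; exists (u k), k.
  apply: filter_from_filter; first by exists 0%N.
  move=> N M _ _; exists (maxn N M) => // _ [k [+ Vk] <-].
  by rewrite geq_max => /andP[Nk Mk]; split; exists k.
have FK : F K by exists 0%N => // _ [k [_ Vk] <-]; exact: VK.
have [a [Ka aF]] := cK F FF FK; exists a => // U aU N.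
pose tail := [set u k | k in [set k | (N <= k)%N /\ V k]].
have Ftail : F tail by exists N.
by have [_ [[k [Nk Vk] <-] Uk]] := aF tail U Ftail aU; exists k.
Qed.

(** Otherwise each value is avoided from some index on, and beyond the maximum of these finitely
    many indices no value is left. *)
Lemma frequently_finite {T : eqType} (D : set T) (u : nat -> T) :
  finite_set D -> (forall k, D (u k)) ->
  exists a, forall N, exists2 k, (N <= k)%N & u k = a.
Proof.
move=> /finite_seqP[s ->] us; apply: contrapT => /forallNP no.
suff [N NN] : exists N, forall k, (N <= k)%N -> u k \notin s.
  by have := us N; rewrite /= (negbTE (NN _ (leqnn _))).
elim: s {us} => [|a s [N NN]]; first by exists 0%N.
have /existsNP[M MM] := no a; exists (maxn N M) => k.
rewrite geq_max => /andP[Nk Mk]; rewrite inE negb_or NN// andbT.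
by apply/eqP => uk; apply: MM; exists k.
Qed.

Lemma seq_argmin {R : realType} {T : choiceType} (s : seq T) (v : T -> R) y0 :
  y0 \in s -> exists2 y, y \in s & forall y', y' \in s -> v y <= v y'.
Proof.
move=> y0s.
have [[y ys] _ ymin] :=
  arg_minP (fun i : seq_sub s => v (ssval i)) (erefl : xpredT (SeqSub y0s)).
by exists y => // y' y's; exact: ymin (SeqSub y's) isT.
Qed.

Lemma closed_le_continuous {R : realType} {T : topologicalType} (h : T -> R)
    (a : R) :
  continuous h -> closed [set x | h x <= a].
Proof.
by move=> hc; apply: (preimage_closed _ (@closed_le _ a)) => x _; exact: hc.
Qed.

(** * Points with a fixed integer part *)

Section Points.
Context {R : realType} {n m : nat}.
Implicit Types (x v : 'rV[R]_n) (y : 'rV[int]_m).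

Lemma continuous_pt y : continuous (fun x => pt x y).
Proof.
move=> x A [Q Qx QA].
(* Matrix neighbourhoods are entrywise: keep the columns of [x], since those of [y] are constant. *)
exists (fun i j => Q i (lshift m j)) => [i j|x' Qx'].
  by have := Qx i (lshift m j); rewrite /pt row_mxEl.
apply: QA => i j; case: (split_ordP j) => k ->.
  by rewrite /pt row_mxEl; exact: Qx'.
by have := nbhs_singleton (Qx i (rshift n k)); rewrite /pt !row_mxEr.
Qed.

Lemma ptB x x' y : pt x' y - pt x y = row_mx (x' - x) 0.
Proof. by rewrite /pt opp_row_mx add_row_mx subrr. Qed.

(** Links gradient cuts at a fixed integer part to the partial gradients in
    [first_order_directions]. *)
Lemma dot_ptB (u : 'rV[R]_(n + m)) x x' y :
  dot u (pt x' y - pt x y) = dot (lsubmx u) (x' - x).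
Proof. by rewrite ptB dot_row_mxr0. Qed.

End Points.

(** * Solvability of the subproblems and the effect of the cuts *)

Section Problem.
Context {R : realType} {n m p q : nat} {P : minlp R n m p q}.
Hypothesis hP : convex_minlp P.

Local Notation X := (cont_set P).
Local Notation Y := (int_set P).
Local Notation g := (constr P).
Local Notation f := (objective P).

Lemma objectiveB x x' y : f x' y - f x y = dot (cost_x P) (x' - x).
Proof. by rewrite /objective dotBr opprD addrACA subrr addr0. Qed.

Lemma continuous_objective y : continuous (fun x => f x y).
Proof.
move=> x.
apply: (@cvgD _ _ _ (nbhs x)); last exact: cvg_cst.
by apply: (@cvg_dot _ _ (nbhs x)); [exact: cvg_cst | exact: cvg_id].
Qed.

Lemma continuous_constr i y : continuous (fun x => g i (pt x y)).
Proof.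
move=> x; case: hP => _ _ _ _ /(_ i)[diff _].
apply: (@continuous_comp _ _ _ (fun x => pt x y) (g i)).
  exact: continuous_pt.
exact: differentiable_continuous (diff _).
Qed.

Lemma closed_constr y : closed [set x | forall i, g i (pt x y) <= 0].
Proof.
rewrite (_ : mkset _ = \bigcap_(i in setT) [set x | g i (pt x y) <= 0]).
  apply: closed_bigI => i _; apply: closed_le_continuous.
  exact: continuous_constr.
by apply/seteqP; split => x h i; [move=> _; exact: h | exact: h].
Qed.

Lemma closed_satisfies
    (C : set (Defs.cut (R := R) (n := n) (m := m) (p := p))) y :
  closed [set x | forall w, C w -> satisfies P (pt x y) w].
Proof.
rewrite (_ : mkset _ = \bigcap_(w in C) [set x | satisfies P (pt x y) w])//.
apply: closed_bigI => -[i z] _; apply: closed_le_continuous => x.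
apply: (@cvgD _ _ _ (nbhs x)); first exact: cvg_cst.
apply: (@cvg_dot _ _ (nbhs x)); first exact: cvg_cst.
by apply: (@cvgB _ _ _ (nbhs x)); [exact: continuous_pt | exact: cvg_cst].
Qed.

(** Minimize over [x] by compactness for each [y], then over the finitely many [y]. Here [S] stands
    for the constraints of (P) or for a collection of cuts. *)
Lemma minimizer_exists (S : 'rV[R]_n -> 'rV[int]_m -> Prop) :
  (forall y, closed [set x | S x y]) ->
  (exists x y, [/\ X x, Y y & S x y]) ->
  exists x y, [/\ X x, Y y & S x y] /\
    forall x' y', [/\ X x', Y y' & S x' y'] -> f x y <= f x' y'.
Proof.
case: hP => _ cX /finite_seqP[s ->] _ _ cS ex.
(* An empty slice gets the dummy minimizer 0; [s'] below discards such [y]. *)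
have slice y : exists z, (exists x, X x /\ S x y) ->
    [/\ X z, S z y & forall x, X x -> S x y -> f z y <= f x y].
  have [ney|] := pselect (exists x, X x /\ S x y); last by exists 0.
  have [] := compact_EVT_min (T := 'rV[R]_n) (f := f ^~ y)
    (A := X `&` [set x | S x y]) ney.
  - exact: compact_closedI.
  - by apply: continuous_subspaceT; exact: continuous_objective.
  move=> z /set_mem[Xz Sz] zmin; exists z => _; split => // x Xx Sx.
  by apply: zmin; apply/mem_set.
have {slice} [z zP] := choice slice.
pose s' := [seq y <- s | `[< exists x, X x /\ S x y >]].
have s'P x y : X x -> y \in s -> S x y -> y \in s'.
  by move=> Xx ys Sxy; rewrite mem_filter ys andbT; apply/asboolP; exists x.
have [x0 [y0 [Xx0 ys0 Sxy0]]] := ex.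
have [y ys' ymin] := seq_argmin (fun y => f (z y) y) (s'P _ _ Xx0 ys0 Sxy0).
move: (ys'); rewrite mem_filter => /andP[/asboolP ney ys].
have [Xzy Szy _] := zP y ney.
exists (z y), y; split => // x' y' [Xx' ys'' Sx'].
apply: le_trans (ymin _ (s'P _ _ Xx' ys'' Sx')) _.
by have [|_ _] := zP y' _; [exists x' | exact].
Qed.

Lemma feasible_satisfies x y w : feasible P x y -> satisfies P (pt x y) w.
Proof.
case: w => i z [_ _ gle]; case: hP => _ _ _ cvx diff; rewrite /satisfies.
apply: le_trans (gle i); apply: gradient_inequality; first exact: cvx.
by case: (diff i).
Qed.

Lemma feasible_milp C x y : feasible P x y -> milp_feasible P C x y.
Proof.
move=> fxy; case: (fxy) => ? ? ?; split => // w _.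
exact: feasible_satisfies.
Qed.

Hypothesis hfeas : exists x y, feasible P x y.

Lemma optimal_exists : exists x y, optimal P x y.
Proof.
exact: (@minimizer_exists
  (fun x y => forall i, g i (pt x y) <= 0) closed_constr hfeas).
Qed.

Lemma milp_optimal_exists C : exists x y, milp_optimal P C x y.
Proof.
have [x [y fxy]] := hfeas.
exact: (minimizer_exists (@closed_satisfies C)
  (ex_intro _ x (ex_intro _ y (feasible_milp C fxy)))).
Qed.

Lemma milp_optimal_le C x y x' y' :
  milp_optimal P C x y -> feasible P x' y' -> f x y <= f x' y'.
Proof. by move=> [_ mo] /(feasible_milp C); exact: mo. Qed.

Lemma Ystar_nlp_optimal y : Ystar P y -> exists x, nlp_optimal P y x.
Proof.
move=> [x [[Xx Yy gx] opt]]; exists x; split => // x' [Xx' gx'].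
exact: opt.
Qed.

Lemma nlp_optimal_Ystar x y : Ystar P y -> nlp_optimal P y x -> optimal P x y.
Proof.
move=> [x0 [[Xx0 Yy gx0] opt]] [[Xx gx] nopt]; split=> // x' y' fx'.
exact: le_trans (nopt x0 _) (opt _ _ fx').
Qed.

(** Rules out the stuck alternative in [execution]. *)
Lemma iteration_exists viol : feasibility_cuts_exclude P viol ->
  forall s, exists s', iteration P viol s s'.
Proof.
move=> hcuts s; have [x [y xyopt]] := milp_optimal_exists (cuts s).
have [[Xx Yy _] _] := xyopt.
have [D newD] : exists D, new_cuts P viol x y D.
  have [feas|infeas] := pselect (nlp_feasible P y); last first.
    have [[xb sol] _] := hcuts y Yy infeas.
    by exists (gradient_cuts_at (pt xb y)); exact: OA_feasibility_cut.
  have [ys|nys] := pselect (Ystar P y).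
    have [xb xbopt] := Ystar_nlp_optimal ys.
    by eexists; exact: OA_cut ys xbopt.
  have [[i0]|noi] := pselect (inhabited 'I_p).
    have [i _ imax] := arg_maxP (fun i => g i (pt x y)) (erefl : xpredT i0).
    by eexists; apply: ECP_cut feas nys _ => j; exact: imax.
  (* With no constraint at all ([p = 0]) there is no ECP cut to choose, but then the MILP solution
     is optimal for (P), so [y] is in [Ystar]. *)
  exfalso; apply: nys; exists x; split; last first.
    by move=> x' y'; exact: milp_optimal_le xyopt.
  by split => // i; exfalso; apply: noi.
pose ub := if `[< nlp_feasible P y >] then Order.min (ubd s) (nlp_value P y)
  else ubd s.
pose C := if `[< (f x y)%:E = ub >] then cuts s else cuts s `|` D.
exists (State C (f x y)%:E ub), x, y; split => //.
- by rewrite /= /ub => /asboolP ->.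
- by rewrite /= /ub => /asboolPn /negbTE ->.
rewrite /stopped/= /C.
by case: ifPn => [->//|/negbTE ->]; exists D.
Qed.

Lemma oa_cut_le xb x y :
  abadie P y xb -> nlp_optimal P y xb -> X x ->
  (forall i, g i (pt xb y) = 0 -> satisfies P (pt x y) (i, pt xb y)) ->
  f xb y <= f x y.
Proof.
move=> cq [[Xxb gxb] opt] Xx sat.
have : first_order_directions P y xb (x - xb).
  split=> i.
    by move=> gi0; have := sat i gi0; rewrite /satisfies gi0 add0r dot_ptB.
  by move=> ai; rewrite dotBr ai subr_le0; exact: Xx.
rewrite -cq => -[u [t [uS t0 _ _ uv]]].
rewrite -subr_ge0 objectiveB.
(* Each [u k] is feasible for NLP(y), so optimality of [xb] makes the cost along every quotient
   nonnegative, hence also along the limit [x - xb]. *)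
apply: (cvgr_to_ge (cvg_dot (cvg_cst (cost_x P)) uv)).
apply: nearW => k /=; rewrite dotZr mulr_ge0 ?invr_ge0 ?(ltW (t0 k))//.
by rewrite -(objectiveB _ _ y) subr_ge0 opt.
Qed.

Lemma ecp_cuts_limit y (V : nat -> Prop) (u : nat -> 'rV[R]_n) (v : R) :
  (forall N, exists2 k, (N <= k)%N & V k) ->
  (forall k, V k -> X (u k) /\ f (u k) y <= v) ->
  (forall k, V k -> exists2 i, forall j, g j (pt (u k) y) <= g i (pt (u k) y) &
     forall l, (k < l)%N -> V l -> satisfies P (pt (u l) y) (i, pt (u k) y)) ->
  exists a, [/\ X a, f a y <= v & forall j, g j (pt a y) <= 0].
Proof.
move=> Vinf VX Vcut; case: hP => _ cX _ _ diff.
have closed_fv := closed_le_continuous (a := v) (@continuous_objective y).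
have [a [Xa fa] acl] :=
  cluster_frequently (compact_closedI cX closed_fv) VX Vinf.
exists a; split => // j; rewrite leNgt; apply/negP => gj0.
(* The most violated index [i] may change with the visit. Replacing [g i] by the fixed [g j] in the
   constant term bounds the cut from below, with the same positive limit for every [i]. *)
pose h i (xx : 'rV[R]_n * 'rV[R]_n) :=
  g j (pt xx.1 y) + dot (grad (g i) (pt xx.1 y)) (pt xx.2 y - pt xx.1 y).
have hc i : h i @ (a, a) --> g j (pt a y).
  rewrite -[X in _ --> X]addr0 -(dotr0 (grad (g i) (pt a y))).
  rewrite -(subrr (pt a y)).
  have cf : (fun xx : 'rV[R]_n * 'rV[R]_n => xx.1) @ nbhs (a, a) --> a.
    exact: cvg_fst.
  have cs : (fun xx : 'rV[R]_n * 'rV[R]_n => xx.2) @ nbhs (a, a) --> a.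
    exact: cvg_snd.
  have c1 := cvg_comp _ _ cf (@continuous_pt _ _ _ y a).
  have c2 := cvg_comp _ _ cs (@continuous_pt _ _ _ y a).
  apply: (@cvgD _ _ _ (nbhs (a, a))).
    exact: (cvg_comp _ _ cf (@continuous_constr j y a)).
  apply: (@cvg_dot _ _ (nbhs (a, a))).
    apply: (cvg_comp _ _ c1); case: (diff i) => _; exact.
  exact: (@cvgB _ _ _ (nbhs (a, a))).
(* Uniformity over the finitely many [i] lets the neighbourhood be fixed before the visit [k], which
   determines [i]. *)
have : \forall xx \near (a, a), forall i, 0 < h i xx.
  apply: (@filter_forall _ _ (fun i xx => 0 < h i xx) _ (nbhs_filter (a, a))).
  by move=> i; exact: (cvgr_gt _ (hc i)).
move=> [[U1 U2] [/= aU1 aU2] Uh].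
have aU : nbhs a (U1 `&` U2) by exact: filterI.
have [k [_ Vk [U1k _]]] := acl _ aU 0%N.
have [l [kl Vl [_ U2l]]] := acl _ aU k.+1.
have [i imax sat] := Vcut k Vk.
have := Uh (u k, u l) (conj U1k U2l) i; rewrite /h/= ltNge => /negP; apply.
by apply: le_trans (sat l kl Vl); rewrite lerD2r.
Qed.

End Problem.

(** * Finite termination *)

Theorem theorem7 (R : realType) (n m p q : nat) (P : minlp R n m p q)
    (viol : 'rV[int]_m -> 'rV[R]_p -> \bar R)
    (hP : convex_minlp P)
    (hviol : violation_measure viol)
    (hcuts : feasibility_cuts_exclude P viol)
    (hfeas : exists x y, feasible P x y)
    (hCQ : forall y, Ystar P y -> forall x, nlp_optimal P y x -> abadie P y x)
    (s : nat -> state)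
    (hs : execution P viol s) :
  exists k : nat, stopped (s k).
Proof.
apply: contrapT => /forallNP ns.
have it k : exists xy, milp_optimal P (cuts (s k)) xy.1 xy.2 /\
    [/\ lbd (s k.+1) = (objective P xy.1 xy.2)%:E,
        nlp_feasible P xy.2 ->
          ubd (s k.+1) = Order.min (ubd (s k)) (nlp_value P xy.2),
        ~ nlp_feasible P xy.2 -> ubd (s k.+1) = ubd (s k) &
        exists2 D, new_cuts P viol xy.1 xy.2 D &
          cuts (s k.+1) = cuts (s k) `|` D].
  have [[x [y [mo lb ubf ubi ct]]]|[stuck _]] := hs.2 k (ns k); last first.
    by exfalso; apply: stuck; exact: iteration_exists.
  by exists (x, y); split => //; split => //; move: ct; case: asboolP => // /ns.
have {it} [xy xyP] := choice it.
pose x k := (xy k).1; pose y k := (xy k).2.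
have mo k : milp_optimal P (cuts (s k)) (x k) (y k) by case: (xyP k).
have Yy k : int_set P (y k) by case: (mo k) => -[].
have cuts_mono k l : (k <= l)%N -> cuts (s k) `<=` cuts (s l).
  elim: l => [|l IH]; first by rewrite leqn0 => /eqP ->.
  rewrite leq_eqVlt => /predU1P[->//|]; rewrite ltnS => /IH kl w /kl sw.
  by case: (xyP l) => _ [_ _ _ [D _ ->]]; left.
have [x0 [y0 opt0]] := optimal_exists hP hfeas.
pose fs := objective P x0 y0.
have fs_le x' y' : feasible P x' y' -> fs <= objective P x' y' by exact: opt0.2.
have lb_le k : objective P (x k) (y k) <= fs.
  by apply: (milp_optimal_le hP (mo k)); exact: opt0.1.
have fs_ub k : (fs%:E <= ubd (s k))%E.
  elim: k => [|k IH]; first by case: hs => -[_ _ ->] _; rewrite leey.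
  have [_ [_ ubf ubi _]] := xyP k.
  have [feas|infeas] := pselect (nlp_feasible P (xy k).2); last by rewrite ubi.
  rewrite ubf// le_min IH/=; apply: le_ereal_inf_tmp => _ [x' [Xx' gx'] <-].
  by rewrite lee_fin; apply: fs_le; split => //; exact: Yy.
have Yfin : finite_set (int_set P) by case: hP.
have [yy yy_inf] := frequently_finite Yfin Yy.
(* Cuts are never removed, so those added at one visit to [yy] bind at all later visits. *)
have cutk k : y k = yy -> exists2 D, new_cuts P viol (x k) yy D &
    forall l, (k < l)%N -> y l = yy ->
      forall w, D w -> satisfies P (pt (x l) yy) w.
  move=> <-; have [_ [_ _ _ [D newD cE]]] := xyP k.
  exists D => // l kl ylk w Dw.
  rewrite -ylk; case: (mo l) => -[_ _ sat] _; apply: sat.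
  by apply: cuts_mono kl _ _; rewrite cE; right.
have Xx k : cont_set P (x k) by case: (mo k) => -[].
have [k _ yk] := yy_inf 0%N.
have [l kl yl] := yy_inf k.+1.
have Yyy : int_set P yy by rewrite -yk.
have [D newD /(_ l kl yl) sat] := cutk k yk.
case: newD sat => [xb infeas sol|xb ys opt|i feas nys _] sat.
- by case: (hcuts yy Yyy infeas) => _ /(_ xb sol); apply; exists (x l).
- have xbopt := nlp_optimal_Ystar ys opt.
  have xb_fs : objective P xb yy = fs.
    apply/eqP; rewrite eq_le; apply/andP; split.
      by apply: xbopt.2; exact: opt0.1.
    by apply: fs_le; exact: xbopt.1.
  have fs_l : fs <= objective P (x l) yy.
    rewrite -xb_fs; apply: (oa_cut_le (hCQ _ ys _ opt) opt (Xx l)) => i gi0.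
    exact: sat.
  have feas : nlp_feasible P yy by exists xb; exact: opt.1.
  have [_ [lb ubf _ _]] := xyP l.
  have val_fs : (nlp_value P yy <= fs%:E)%E.
    by rewrite -xb_fs; apply: ereal_inf_lbound; exists xb => //; exact: opt.1.
  (* The bounds computed in iteration [l] are stored in state [l.+1]; both equal [fs]. *)
  apply: (ns l.+1); rewrite /stopped.
  apply/eqP; rewrite eq_le; apply/andP; split.
    by apply: le_trans (fs_ub l.+1); rewrite lb lee_fin; exact: lb_le.
  rewrite lb (ubf _); last by rewrite -/(y l) yl.
  rewrite -/(x l) -/(y l) yl ge_min; apply/orP; right.
  by apply: (le_trans val_fs); rewrite lee_fin.
(* Two visits do not suffice here: all the infinitely many visits to [yy] are used. *)
- have [||a [Xa fa ga]] := ecp_cuts_limit (y := yy) (V := fun k => y k = yy)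
    (u := x) (v := fs) hP yy_inf.
  + by move=> k' yk'; split; [exact: Xx | rewrite -yk'; exact: lb_le].
  + move=> k' /cutk[D' newD' sat'].
    (* The kind of cut depends only on [yy], so every visit adds an ECP cut. *)
    case: newD' sat' => [? /(_ feas)//|? /nys//|i' _ _ i'max] sat'.
    by exists i' => // l' kl' yl'; exact: sat'.
  apply: nys; exists a; split; first by split.
  by move=> x' y' /fs_le; exact: le_trans.
Qed.
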